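(* For any $\epsilon,\delta>0$ and any distribution $\mathcal{D}$ over component maintenance games with $n$ agents (with repair costs at most $H$), $O\!\left(\frac{n^2H^2}{\epsilon^2}\left(n+\log\frac1\delta\right)\right)$ games drawn i.i.d. from $\mathcal{D}$ suffice to ensure that, with probability at least $1-\delta$ over the draw, the uniform subsidy value $\hat\sigma\in[0,H]$ minimizing the average loss $L_{\mathrm{prior}}$ over the sample has expected loss $\mathbb{E}_{G\sim\mathcal{D}}[L_{\mathrm{prior}}^G(\hat\sigma)]$ at most $\epsilon$ larger than $\min_{\sigma\in[0,H]}\mathbb{E}_{G\sim\mathcal{D}}[L_{\mathrm{prior}}^G(\sigma)]$.
   Context: Component maintenance game with $n$ agents: agent $i$ owns component $i$ with random state $x_i\in\{0,1\}$ under a common prior $\theta$ (independent components), Boolean system function $\phi$, repair costs $C_i\le H$. Agent $i$ chooses $s_i\in\{0,1\}$ (1 = repair); post-action state $x_i'=\max\{x_i,s_i\}$; expected cost $l_i(s)=C_is_i+1-\mathbb{E}_\theta[\phi(\bm{x}'(s))]$. A uniform subsidy $\sigma\in[0,H]$ reduces the repair cost of every agent who repairs by $\sigma$, i.e. subsidized cost $l_i(s)-\sigma s_i$. Let $\mathcal{S}_{NE}(\sigma)$ be the set of pure Nash equilibria of the subsidized game, $\mathrm{cost}^\sigma(s)=\sum_i(l_i(s)-\sigma s_i)$, and $n_s$ the number of agents repairing in $s$. The loss of game $G$ is $L_{\mathrm{prior}}^G(\sigma)=\max_{s\in\mathcal{S}_{NE}(\sigma)}\mathrm{cost}^\sigma(s)+n_s\sigma$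 (at most $(2H+1)n$).
   Formalization: The bound H on the repair costs is assumed to be at least 1: the loss ranges over an interval of length about (H+1)n whatever H is, so with a universal constant the stated O(n²H²/ε²(n+log 1/δ)) sample size is too small when H tends to 0. *)

(* Defs.v *)
From HB Require Import structures.
From mathcomp Require Import all_boot all_order all_algebra.
From mathcomp Require Import all_classical all_reals all_analysis.
Set Implicit Arguments. Unset Strict Implicit. Unset Printing Implicit Defensive.
Import Order.TTheory GRing.Theory Num.Theory.
Local Open Scope classical_set_scope.
Local Open Scope ring_scope.

Section CMG.
Variables (R : realType) (n : nat).

(* An action profile / component state vector in {0,1}^n (true = 1). *)
Definition profile := {ffun 'I_n -> bool}.

(* A component maintenance game with n agents:
   theta i = Pr_theta[x_i = 1] (independent components),
   phi     = Boolean system function,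
   cost i  = repair cost C_i of agent i. *)
Record game := Game {
  theta : 'I_n -> R;
  phi : profile -> bool;
  cost : 'I_n -> R }.

Definition valid_game (H : R) (G : game) : Prop :=
  (forall i, 0 <= theta G i <= 1) /\ (forall i, 0 <= cost G i <= H).

Definition post_state (x s : profile) : profile := [ffun i => x i || s i].

Definition prior_prob (G : game) (x : profile) : R :=
  \prod_i (if x i then theta G i else 1 - theta G i).

Definition reliability (G : game) (s : profile) : R :=
  \sum_(x : profile) prior_prob G x * (phi G (post_state x s))%:R.

Definition agent_cost (G : game) (i : 'I_n) (s : profile) : R :=
  cost G i * (s i)%:R + 1 - reliability G s.

Definition sub_cost (G : game) (sigma : R) (i : 'I_n) (s : profile) : R :=
  agent_cost G i s - sigma * (s i)%:R.

Definition deviate (s : profile) (i : 'I_n) (b : bool) : profile :=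
  [ffun j => if j == i then b else s j].

Definition is_NE (G : game) (sigma : R) (s : profile) : bool :=
  [forall i, forall b, sub_cost G sigma i s <= sub_cost G sigma i (deviate s i b)].

Definition social_cost (G : game) (sigma : R) (s : profile) : R :=
  \sum_i sub_cost G sigma i s.

Definition n_repair (s : profile) : nat := #|[set i | s i]|.

(* L_prior^G(sigma) = max_{s in S_NE(sigma)} cost^sigma(s) + n_s sigma.
   (Pure NE always exist here -- potential game -- and the quantity is >= 0,
   so the default value 0 of the max is immaterial.) *)
Definition loss_prior (G : game) (sigma : R) : R :=
  \big[Num.max/0]_(s : profile | is_NE G sigma s)
     (social_cost G sigma s + (n_repair s)%:R * sigma).

Definition avg_loss (m : nat) (Gs : 'I_m -> game) (sigma : R) : R :=
  (\sum_(k < m) loss_prior (Gs k) sigma) / m%:R.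

Definition is_ERM (H : R) (m : nat) (Gs : 'I_m -> game) (sh : R) : Prop :=
  0 <= sh <= H /\
  forall sigma, 0 <= sigma <= H -> avg_loss Gs sh <= avg_loss Gs sigma.

End CMG.

Section Prob.
Variables (R : realType).

(* Expected loss E_{G ~ D}[L_prior^G(sigma)], where the distribution D over
   games is given as a probability D on a measurable space Om together with
   the map g : Om -> game (the law of G is the pushforward of D by g). *)
Definition exp_loss (d : measure_display) (Om : measurableType d) (n : nat)
    (D : probability Om R) (g : Om -> game R n) (sigma : R) : \bar R :=
  (\int[D]_w (loss_prior (g w) sigma)%:E)%E.

(* X_0, ..., X_{m-1} : S -> Om are i.i.d. with law D:
   measurable, and the joint law is the product law D^m on rectangles. *)
Definition iid (d d' : measure_display) (Om : measurableType d)
    (S : measurableType d') (D : probability Om R) (P : probability S R)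
    (m : nat) (X : 'I_m -> S -> Om) : Prop :=
  (forall k, measurable_fun setT (X k)) /\
  forall A : 'I_m -> set Om, (forall k, measurable (A k)) ->
    P (\bigcap_(k in [set: 'I_m]) (X k @^-1` A k)) =
    (\prod_(k < m) fine (D (A k)))%:E.

End Prob.

(* Main.v *)
Require Import Defs.
From HB Require Import structures.
From mathcomp Require Import all_boot all_order all_algebra.
From mathcomp Require Import all_classical all_reals all_analysis.
From mathcomp Require Import measurable_realfun.
From mathcomp Require Import lra ring zify.
Set Implicit Arguments. Unset Strict Implicit. Unset Printing Implicit Defensive.
Import Order.TTheory GRing.Theory Num.Theory.
Local Open Scope classical_set_scope.
Local Open Scope ring_scope.

(** For a fixed profile, the subsidies at which it is a Nash equilibrium form a
    closed interval, and the loss of an equilibrium does not depend on the subsidy.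
    Hence the loss of a game is an upper semicontinuous step function of the
    subsidy that changes at most [2 ^ n.+1] times along any increasing sequence.

    For such functions, uniform convergence holds without the logarithmic factor of
    a plain union bound, by chaining: along a finite increasing sequence of
    subsidies, the level-[j] cells are intervals carrying an expected number of
    changes at most [4 ^- j], there are at most [2 ^ n.+1 * 4 ^ j + 1] of them,
    and Bernstein's inequality controls the increments between representatives of
    nested cells. The finite sequences exhaust a countable set dense in the graph of
    the expected loss. Upper semicontinuity then carries the bound over to the
    empirical minimizer: the empirical loss at nearby points of the countable set is
    no larger. *)

(** * Bernstein's inequality for a finite product law *)

Section FiniteProduct.
Variables (R : realType) (V : finType) (p : V -> R).
Hypotheses (p_ge0 : forall v, 0 <= p v) (p_sum1 : \sum_v p v = 1).

Definition mean (h : V -> R) : R := \sum_v p v * h v.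

Definition prodPr (m : nat) (E : pred {ffun 'I_m -> V}) : R :=
  \sum_(y | E y) \prod_i p (y i).

Definition emp_mean (m : nat) (y : {ffun 'I_m -> V}) (h : V -> R) : R :=
  (\sum_(i < m) h (y i)) / m%:R.

Lemma mean_le (h1 h2 : V -> R) :
  (forall v, h1 v <= h2 v) -> mean h1 <= mean h2.
Proof. by move=> h12; apply: ler_sum => v _; rewrite ler_wpM2l. Qed.

Lemma meanB (h1 h2 : V -> R) :
  mean (fun v => h1 v - h2 v) = mean h1 - mean h2.
Proof. by rewrite /mean -sumrB; apply: eq_bigr => v _; rewrite mulrBr. Qed.

Lemma meanN (h : V -> R) : mean (fun v => - h v) = - mean h.
Proof. by rewrite /mean -sumrN; apply: eq_bigr => v _; rewrite mulrN. Qed.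

Lemma mean_const (c : R) : mean (fun=> c) = c.
Proof. by rewrite /mean -mulr_suml p_sum1 mul1r. Qed.

Lemma emp_mean_le (m : nat) (y : {ffun 'I_m -> V}) (h1 h2 : V -> R) :
  (forall v, h1 v <= h2 v) -> emp_mean y h1 <= emp_mean y h2.
Proof.
by move=> h12; rewrite ler_wpM2r ?invr_ge0 ?ler0n//; apply: ler_sum.
Qed.

Lemma emp_meanB (m : nat) (y : {ffun 'I_m -> V}) (h1 h2 : V -> R) :
  emp_mean y (fun v => h1 v - h2 v) = emp_mean y h1 - emp_mean y h2.
Proof. by rewrite /emp_mean sumrB mulrBl. Qed.

Lemma emp_meanN (m : nat) (y : {ffun 'I_m -> V}) (h : V -> R) :
  emp_mean y (fun v => - h v) = - emp_mean y h.
Proof. by rewrite /emp_mean sumrN mulNr. Qed.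

Lemma prod_ge0 (m : nat) (y : {ffun 'I_m -> V}) : 0 <= \prod_i p (y i).
Proof. exact: prodr_ge0. Qed.

Lemma prodPr_le (m : nat) (E1 E2 : pred {ffun 'I_m -> V}) :
  (forall y, E1 y -> E2 y) -> prodPr E1 <= prodPr E2.
Proof.
move=> E12; rewrite /prodPr big_mkcond [leRHS]big_mkcond/=.
apply: ler_sum => y _; case: ifPn => [/E12 ->//|_].
by case: ifPn => // _; exact: prod_ge0.
Qed.

Lemma prodPrU (m : nat) (E1 E2 : pred {ffun 'I_m -> V}) :
  prodPr (fun y => E1 y || E2 y) <= prodPr E1 + prodPr E2.
Proof.
rewrite /prodPr [leLHS]big_mkcond [X in _ <= X + _]big_mkcond.
rewrite [X in _ <= _ + X]big_mkcond -big_split/=.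
apply: ler_sum => y _; case: (E1 y) => /=; last by rewrite add0r.
by case: ifP => _; rewrite ?addr0// lerDl prod_ge0.
Qed.

Lemma prodPr_has (m : nat) (T : eqType) (s : seq T)
    (E : T -> pred {ffun 'I_m -> V}) :
  prodPr (fun y => has (fun t => E t y) s) <= \sum_(t <- s) prodPr (E t).
Proof.
elim: s => [|t s IH]; first by rewrite big_nil /prodPr big_pred0.
by rewrite big_cons (le_trans (prodPrU _ _))// lerD2l.
Qed.

(** From [1 - x <= expR (- x)], [expR x <= (1 - x)^-1]; and [(1 + x + 2 * x ^+ 2) * (1 - x) - 1 = x
    ^+ 2 * (1 - 2 * x)] is nonnegative. *)
Lemma expR_le_quadratic (x : R) : x <= 1 / 2 -> expR x <= 1 + x + 2 * x ^+ 2.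
Proof.
move=> x12; have := expR_ge1Dx (- x) => e1.
have x1 : 0 < 1 - x by lra.
have -> : expR x = (expR (- x))^-1 by rewrite expRN invrK.
apply: (@le_trans _ _ (1 - x)^-1); first by rewrite lef_pV2 ?posrE ?expR_gt0.
rewrite -[leLHS]mul1r ler_pdivrMr//.
have : 0 <= x ^+ 2 * (1 - 2 * x) by rewrite mulr_ge0 ?sqr_ge0//; lra.
by rewrite expr2; nra.
Qed.

(** Chernoff's method with the quadratic bound on the exponential. [Z] is bounded from above only,
    so the tail is one-sided; [lam] stays free, to be chosen level by level. *)
Lemma prodPr_bernstein (m : nat) (Z : V -> R) (var lam eta : R) :
  (0 < m)%N -> (forall v, Z v <= 1) -> mean (fun v => Z v ^+ 2) <= var ->
  0 <= lam <= 1 / 2 ->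
  prodPr (fun y : {ffun 'I_m -> V} => mean Z + eta < emp_mean y Z)
    <= expR (- (m%:R * (lam * eta - 2 * lam ^+ 2 * var))).
Proof.
move=> m0 Z1 Zvar /andP[lam0 lam12].
have m0R : 0 < m%:R :> R by rewrite ltr0n.
pose W v := expR (lam * (Z v - mean Z - eta)).
have PW (y : {ffun 'I_m -> V}) : mean Z + eta < emp_mean y Z ->
    1 <= \prod_i W (y i).
  move=> yE; rewrite -expR_sum -expR0 ler_expR -mulr_sumr mulr_ge0//.
  rewrite !sumrB !sumr_const card_ord.
  move: yE; rewrite /emp_mean ltr_pdivlMr// => /ltW.
  by rewrite mulrDl -[_ *+ m]mulr_natr -[eta *+ m]mulr_natr; lra.
(* Markov's inequality: the product of the [W (y i)] dominates the indicator of the event, and its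
   expectation factors over the coordinates. *)
apply: (@le_trans _ _ (\sum_(y : {ffun 'I_m -> V}) \prod_i (p (y i) * W (y i)))).
  rewrite /prodPr big_mkcond; apply: ler_sum => y _.
  rewrite big_split/=; case: ifPn => [/PW yW|_].
    by rewrite ler_peMr// prod_ge0.
  by rewrite mulr_ge0 ?prod_ge0// prodr_ge0// => i _; rewrite expR_ge0.
rewrite -(bigA_distr_bigA (fun (_ : 'I_m) v => p v * W v))/=.
rewrite prodr_const card_ord -mulrN expRM_natl lerXn2r ?nnegrE ?expR_ge0//.
  by apply: sumr_ge0 => v _; rewrite mulr_ge0 ?expR_ge0.
have -> : \sum_v p v * W v =
    expR (- (lam * (mean Z + eta))) * mean (fun v => expR (lam * Z v)).
  rewrite /mean mulr_sumr; apply: eq_bigr => v _.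
  by rewrite /W mulrCA -expRD; congr (_ * expR _); rewrite /mean; ring.
have MGF : mean (fun v => expR (lam * Z v)) <=
    expR (lam * mean Z + 2 * lam ^+ 2 * var).
  apply: le_trans (expR_ge1Dx _).
  apply: (@le_trans _ _
    (mean (fun v => 1 + lam * Z v + 2 * (lam * Z v) ^+ 2))).
    apply: mean_le => v; apply: expR_le_quadratic.
    have := Z1 v; nra.
  have -> : mean (fun v => 1 + lam * Z v + 2 * (lam * Z v) ^+ 2) =
      1 + (lam * mean Z + 2 * lam ^+ 2 * mean (fun v => Z v ^+ 2)).
    rewrite -[X in _ = X + _](mean_const 1) /mean !mulr_sumr -!big_split/=.
    by apply: eq_bigr => v _; ring.
  by rewrite lerD2l lerD2l ler_wpM2l// mulr_ge0 ?sqr_ge0.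
apply: (le_trans (ler_wpM2l (expR_ge0 _) MGF)).
by rewrite -expRD ler_expR; lra.
Qed.

End FiniteProduct.

(** * Chaining *)

Section Chaining.
Variables (R : realType) (V : finType) (p : V -> R).
Hypotheses (p_ge0 : forall v, 0 <= p v) (p_sum1 : \sum_v p v = 1).
Variables (N K : nat) (f : nat -> V -> R).
Hypothesis f01 : forall k v, 0 <= f k v <= 1.
Hypothesis f_jumps :
  forall v, p v != 0 -> (\sum_(0 <= i < N) (f i v != f i.+1 v) <= K)%N.

Definition jump_mass (k : nat) : R :=
  \sum_(0 <= i < k) mean p (fun v => (f i v != f i.+1 v)%:R).

Definition jumps (a b : nat) (v : V) : bool :=
  has (fun i => f i v != f i.+1 v) (index_iota a b).

(* Equal values of [cell j] delimit an interval of indices in which the expected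
   number of jumps of [f] is at most [4 ^- j]; the cells of level [j.+1] refine
   those of level [j]. *)
Definition cell (j k : nat) : nat := Num.truncn (4 ^+ j * jump_mass k).

Definition cells (j : nat) : seq nat := undup [seq cell j k | k <- iota 0 N.+1].

Definition cell_first (j c : nat) : nat :=
  find (fun i => cell j i == c) (iota 0 N.+1).

Definition cell_last (j c : nat) : nat := \max_(i < N.+1 | cell j i == c) i.

Lemma jump_mean_ge0 i : 0 <= mean p (fun v => (f i v != f i.+1 v)%:R).
Proof. by apply: sumr_ge0 => v _; rewrite mulr_ge0. Qed.

Lemma jump_mass_cat a b : (a <= b)%N -> jump_mass b - jump_mass a =
  \sum_(a <= i < b) mean p (fun v => (f i v != f i.+1 v)%:R).
Proof.
by move=> ab; rewrite /jump_mass (big_cat_nat (n:=a))//= addrAC subrr add0r.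
Qed.

Lemma jump_mass_le a b : (a <= b)%N -> jump_mass a <= jump_mass b.
Proof.
move=> ab; rewrite -subr_ge0 jump_mass_cat//.
by apply: sumr_ge0 => i _; exact: jump_mean_ge0.
Qed.

Lemma jump_mass_ge0 a : 0 <= jump_mass a.
Proof. by apply: sumr_ge0 => i _; exact: jump_mean_ge0. Qed.

Lemma jump_mass_ub : jump_mass N <= K%:R.
Proof.
rewrite /jump_mass /mean exchange_big/=.
rewrite -[leRHS](mean_const p_sum1) /mean.
apply: ler_sum => v _; rewrite -mulr_sumr.
have [->|pv0] := eqVneq (p v) 0; first by rewrite !mul0r.
by rewrite ler_wpM2l// -natr_sum ler_nat f_jumps.
Qed.

Lemma jumpsNE a b v : (a <= b)%N -> ~~ jumps a b v -> f a v = f b v.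
Proof.
move=> ab; rewrite -(subnKC ab); elim: (b - a)%N => [|k IH]; first by rewrite addn0.
rewrite /jumps /index_iota (_ : a + k.+1 - a = k + 1)%N; last by lia.
rewrite iotaD has_cat negb_or /= orbF negbK addnS.
by move=> /andP[h /eqP <-]; apply: IH; rewrite /jumps /index_iota addKn.
Qed.

Lemma jumps_sub a a' b' b v : (a <= a')%N -> (b' <= b)%N ->
  jumps a' b' v -> jumps a b v.
Proof.
move=> aa' bb' /hasP[i]; rewrite mem_index_iota => /andP[ai ib] fi.
apply/hasP; exists i => //; rewrite mem_index_iota.
by rewrite (leq_trans aa')// (leq_trans ib).
Qed.

Lemma mean_jumps a b : (a <= b)%N ->
  mean p (fun v => (jumps a b v)%:R) <= jump_mass b - jump_mass a.
Proof.
move=> ab; rewrite jump_mass_cat// /mean exchange_big/=.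
apply: ler_sum => v _; rewrite -mulr_sumr ler_wpM2l//.
rewrite -natr_sum ler_nat /jumps; elim: (index_iota a b) => [|i s IH] //=.
by rewrite big_cons; case: (_ != _) => //=; rewrite addnC addn1.
Qed.

Lemma dist_le_jumps a b v : (a <= b)%N -> f a v - f b v <= (jumps a b v)%:R.
Proof.
move=> ab; have [_|nj] := boolP (jumps a b v); last first.
  by rewrite (jumpsNE ab nj) subrr.
by have := f01 a v; have := f01 b v; rewrite /=; lra.
Qed.

Lemma cell_arg_ge0 j a : 0 <= 4 ^+ j * jump_mass a.
Proof. by rewrite mulr_ge0 ?exprn_ge0 ?jump_mass_ge0. Qed.

Lemma cell_ub j k : (k <= N)%N -> (cell j k <= 4 ^ j * K)%N.
Proof.
move=> kN; rewrite -(ler_nat R) /cell.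
have /andP[+ _] := truncn_itv (cell_arg_ge0 j k); move=> /le_trans; apply.
rewrite natrM natrX ler_wpM2l ?exprn_ge0//.
exact: le_trans (jump_mass_le kN) jump_mass_ub.
Qed.

Lemma cell_jump_mass j a b : cell j a = cell j b ->
  jump_mass b - jump_mass a <= 4 ^- j.
Proof.
move=> ab; have /andP[a1 _] := truncn_itv (cell_arg_ge0 j a).
have /andP[_ b1] := truncn_itv (cell_arg_ge0 j b).
rewrite -/(cell _ _) -{}ab in b1; rewrite -/(cell _ _) in a1.
have P : 0 < 4 ^+ j :> R by rewrite exprn_gt0.
rewrite -[leRHS]mul1r ler_pdivlMr// mulrBl ![_ * 4 ^+ j]mulrC.
move: a1 b1; rewrite -[X in _ < X]natr1.
move: (4 ^+ j * _) (4 ^+ j * _) => x z; lra.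
Qed.

(** Truncating [4 * x] and dividing by 4 truncates [x]; this is what nests the cells. *)
Lemma cell_coarsen j a : cell j a = (cell j.+1 a %/ 4)%N.
Proof.
have /andP[] := truncn_itv (cell_arg_ge0 j.+1 a); rewrite -/(cell j.+1 a).
move: (cell j.+1 a) => c; rewrite exprS -mulrA => c1 c2.
apply: truncn_def; have := divn_eq c 4; have := ltn_pmod c (isT : 0 < 4)%N.
move: (c %/ 4)%N (c %% 4)%N => q r r4 cE; rewrite {}cE in c1 c2.
apply/andP; split.
  by move: c1; rewrite natrD natrM; have : 0 <= r%:R :> R by []; lra.
have : (q * 4 + r).+1%:R <= (q.+1 * 4)%:R :> R by rewrite ler_nat; lia.
by rewrite natrM => /(lt_le_trans c2); lra.
Qed.

Lemma cell_firstP j k : (k <= N)%N ->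
  (cell_first j (cell j k) <= k)%N /\
  cell j (cell_first j (cell j k)) = cell j k.
Proof.
move=> kN; set P := fun i => cell j i == cell j k.
have h : has P (iota 0 N.+1).
  by apply/hasP; exists k; rewrite /P ?eqxx// mem_iota.
have fk : (cell_first j (cell j k) <= k)%N.
  rewrite leqNgt; apply/negP => /(before_find 0%N).
  by rewrite nth_iota// add0n eqxx.
split=> //; have := nth_find 0%N h; rewrite nth_iota ?add0n; first by move/eqP.
by rewrite -{2}(size_iota 0 N.+1) -has_find.
Qed.

Lemma cell_lastP j k : (k <= N)%N ->
  [/\ (k <= cell_last j (cell j k))%N, (cell_last j (cell j k) <= N)%N &
  cell j (cell_last j (cell j k)) = cell j k].
Proof.
move=> kN; pose k' : 'I_N.+1 := Ordinal (kN : (k < N.+1)%N).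
pose A := [pred i : 'I_N.+1 | cell j i == cell j k].
have A0 : (0 < #|A|)%N by apply/card_gt0P; exists k'; rewrite inE /= eqxx.
have kl : (k <= cell_last j (cell j k))%N.
  by rewrite /cell_last (leq_bigmax_cond (P := A) (F := id) k')//= eqxx.
have [i iA E] := eq_bigmax_cond (A := A) (fun i => i : nat) A0.
have {}E : cell_last j (cell j k) = i by rewrite -E; apply: eq_bigl.
split=> //; rewrite E; first by rewrite -ltnS.
by move: iA; rewrite inE => /eqP.
Qed.

Lemma size_cells j : (size (cells j) <= 4 ^ j * K + 1)%N.
Proof.
rewrite -(size_iota 0 (4 ^ j * K + 1)); apply: uniq_leq_size.
  exact: undup_uniq.
move=> c; rewrite mem_undup => /mapP[k].
rewrite !mem_iota /= add0n ltnS => kN ->.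
by rewrite add0n addn1 ltnS cell_ub.
Qed.

Lemma cellsP j c : c \in cells j -> exists2 k, (k <= N)%N & c = cell j k.
Proof.
by rewrite mem_undup => /mapP[k]; rewrite mem_iota ltnS => kN ->; exists k.
Qed.

Lemma mem_cells j k : (k <= N)%N -> cell j k \in cells j.
Proof. by move=> kN; rewrite mem_undup map_f// mem_iota. Qed.

(** One step of the chain, parent representative minus child representative. At level 0 the parent
    is the zero function, so the links telescope to minus the value at the last representative:
    upper tails of links bound [mean - emp_mean] for [f]. *)
Definition link (j c : nat) (v : V) : R :=
  (if j is i.+1 then f (cell_first i (cell i (cell_first j c))) v else 0)
  - f (cell_first j c) v.

(** Dominates the difference of [f] between any index of the cell and its representative, for the
    last step of the chain. *)
Definition bracket (j c : nat) (v : V) : R :=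
  (jumps (cell_first j c) (cell_last j c) v)%:R.

Lemma mean_bracket j c : c \in cells j -> mean p (bracket j c) <= 4 ^- j.
Proof.
move=> /cellsP[k kN ->]; have [a1 a2] := cell_firstP j kN.
have [b1 b2 b3] := cell_lastP j kN.
apply: le_trans (mean_jumps (leq_trans a1 b1)) _.
by apply: cell_jump_mass; rewrite a2 b3.
Qed.

Lemma bracket_le1 j c v : bracket j c v <= 1.
Proof. by rewrite /bracket; case: jumps. Qed.

Lemma link_le1 j c v : link j c v <= 1.
Proof.
rewrite /link; case: j => [|j].
  by have := f01 (cell_first 0 c) v; lra.
set a := cell_first _ _; set b := cell_first _ _.
by have := f01 a v; have := f01 b v; lra.
Qed.

Lemma bracket_var j c : c \in cells j ->
  mean p (fun v => bracket j c v ^+ 2) <= 4 * 4 ^- j.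
Proof.
move=> cj; have -> : (fun v => bracket j c v ^+ 2) = bracket j c.
  by apply/funext => v; rewrite /bracket; case: jumps; rewrite /= ?expr1n ?expr0n.
apply: le_trans (mean_bracket cj) _.
by rewrite ler_peMl ?invr_ge0 ?exprn_ge0//; lra.
Qed.

(** Above level 0 a link lies between -1 and 1 and vanishes unless [f] jumps between two indices of
    one parent cell; at level [j.+1] this has probability at most [4 ^- j]. *)
Lemma link_var j c : c \in cells j ->
  mean p (fun v => link j c v ^+ 2) <= 4 * 4 ^- j.
Proof.
move=> /cellsP[k kN ->]; have [a1 a2] := cell_firstP j kN.
case: j a1 a2 => [|j] a1 a2.
  rewrite expr0 invr1 mulr1 -[leRHS](mean_const p_sum1).
  apply: mean_le => // v; rewrite /link add0r sqrrN.
  by have := f01 (cell_first 0 (cell 0 k)) v; nra.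
set b := cell_first j.+1 (cell j.+1 k) in a1 a2 *.
have bN : (b <= N)%N by exact: leq_trans a1 kN.
have [c1 c2] := cell_firstP j bN.
rewrite exprS invfM mulrA mulfV ?mul1r//.
apply: le_trans (_ : jump_mass b - jump_mass (cell_first j (cell j b)) <= _).
  apply: le_trans (mean_jumps c1).
  apply: mean_le => // v; rewrite /link -/b.
  have [_|nj] := boolP (jumps _ _ v); last first.
    by rewrite (jumpsNE c1 nj) subrr expr0n.
  have := f01 b v; have := f01 (cell_first j (cell j b)) v.
  by rewrite /=; nra.
by apply: cell_jump_mass; rewrite c2.
Qed.

(** * From accurate links and brackets to uniform accuracy *)

Section Deterministic.
Variables (m : nat) (y : {ffun 'I_m -> V}) (J : nat) (e : R).
Hypothesis e_gt0 : 0 < e.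

(** The series of [j.+1 / 2 ^ j] sums to 4, so all levels together cost at most [e / 2]; the factor
    [j.+1] pays for the growing number of cells. *)
Let tol (j : nat) : R := e / 8 * (j.+1%:R / 2 ^+ j).

Hypothesis link_good : forall j c, (j <= J)%N -> c \in cells j ->
  emp_mean y (link j c) <= mean p (link j c) + tol j.
Hypothesis bracket_good : forall c, c \in cells J ->
  emp_mean y (bracket J c) <= mean p (bracket J c) + tol J.

(** The tolerances add up along the chain: the sum of [i.+1 / 2 ^ i] for [i <= j] equals
    [4 - j.+3 / 2 ^ j]. *)
Lemma chain_deviation j k : (j <= J)%N -> (k <= N)%N ->
  mean p (f (cell_first j (cell j k))) - emp_mean y (f (cell_first j (cell j k)))
  <= e / 8 * (4 - j.+3%:R / 2 ^+ j).
Proof.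
move=> jJ kN; elim: j jJ => [|j IH] jJ.
  have := link_good jJ (mem_cells 0 kN).
  have -> : link 0 (cell 0 k) = fun v => - f (cell_first 0 (cell 0 k)) v.
    by apply/funext => v; rewrite /link add0r.
  by rewrite emp_meanN meanN /tol expr0; lra.
have := link_good jJ (mem_cells j.+1 kN); rewrite /link.
have [_ c2] := cell_firstP j.+1 kN.
(* The representative shares its cell at level [j.+1] with [k], hence also its cell at level [j], so
   the induction hypothesis for [k] covers the parent. *)
rewrite emp_meanB meanB (cell_coarsen j (cell_first _ _)) c2 -cell_coarsen.
move: {IH}(IH (ltnW jJ)).
have -> : e / 8 * (4 - j.+4%:R / 2 ^+ j.+1) =
    e / 8 * (4 - j.+3%:R / 2 ^+ j) + tol j.+1.
  rewrite /tol exprS -!natr1; field.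
  by rewrite expf_neq0.
lra.
Qed.

(** Passing from the representative to [k] costs a bracket once under [mean] and once under
    [emp_mean]: two terms [4 ^- J] and one tolerance. *)
Lemma uniform_deviation k : (k <= N)%N ->
  mean p (f k) - emp_mean y (f k) <= e / 2 + 2 * 4 ^- J.
Proof.
move=> kN; have [a1 a2] := cell_firstP J kN.
have [b1 b2 b3] := cell_lastP J kN.
have := chain_deviation (leqnn J) kN.
have cJ := mem_cells J kN.
have := bracket_good cJ; have := mean_bracket cJ.
set a := cell_first _ _ in a1 a2 *; set b := cell_last _ _ in b1 b2 b3.
have fak v : f a v - f k v <= bracket J (cell J k) v.
  apply: le_trans (dist_le_jumps v a1) _; rewrite ler_nat.
  have [/(jumps_sub (leqnn a) b1)|//] := boolP (jumps a k v).
  by rewrite -/b => ->.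
have fka v : f k v - f a v <= bracket J (cell J k) v.
  have := fak v; rewrite /bracket -/a -/b; case/boolP: (jumps a b v) => jab.
    by have := f01 k v; have := f01 a v; rewrite /=; lra.
  have njk : ~~ jumps a k v.
    by apply: contra jab; apply: jumps_sub.
  by rewrite (jumpsNE a1 njk) subrr.
have := mean_le p_ge0 fka; rewrite meanB.
have := emp_mean_le y fak; rewrite emp_meanB.
have : e / 8 * (4 - J.+3%:R / 2 ^+ J) + tol J <= e / 2.
  rewrite /tol -mulrDr.
  have : 4 - J.+3%:R / 2 ^+ J + J.+1%:R / 2 ^+ J <= 4 :> R.
    rewrite -addrA gerDl addrC -mulrBl mulr_le0_ge0 ?invr_ge0 ?exprn_ge0 ?subr_le0 ?ler_nat//; lia.
  by move=> x4; rewrite (_ : e / 2 = e / 8 * 4) ?ler_pM2l ?divr_gt0//; field.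
move: (e / 8 * _) => x; lra.
Qed.

End Deterministic.
End Chaining.

(** * Dyadic scales and numerical estimates *)

Lemma dyadic_scale (R : realType) (e : R) : 0 < e <= 1 ->
  exists J, 2 / e <= 2 ^+ J <= 4 / e.
Proof.
move=> /andP[e0 e1].
have exP : exists J, 2 / e <= 2 ^+ J.
  exists (Num.truncn (2 / e)).+1.
  have h : 0 <= 2 / e by rewrite divr_ge0// ltW.
  have /andP[_ /ltW/le_trans] := truncn_itv h.
  by apply; rewrite -natrX ler_nat ltnW// ltn_expl.
have [[|J] PJ minJ] := ex_minnP exP.
  by move: PJ; rewrite expr0 ler_pdivrMr//; lra.
exists J.+1; rewrite PJ /=.
have : ~~ (2 / e <= 2 ^+ J) by apply/negP => /minJ; rewrite ltnn.
by rewrite -ltNge exprS => /ltW h; rewrite (_ : 4 / e = 2 * (2 / e)) ?ler_pM2l//; ring.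
Qed.

Lemma expRN_le_dyadic (R : realType) (k : nat) : expR (- k%:R) <= 2 ^- k :> R.
Proof.
rewrite expRN lef_pV2 ?posrE ?exprn_gt0 ?expR_gt0//.
rewrite -[k%:R]mulr1 expRM_natl lerXn2r ?nnegrE ?expR_ge0//.
by apply: le_trans (expR_ge1Dx 1); lra.
Qed.

Lemma sum_dyadic_le (R : realType) (J : nat) :
  \sum_(0 <= j < J) 2 ^- j.+2 <= 1 / 2 :> R.
Proof.
suff -> : \sum_(0 <= j < J) 2 ^- j.+2 = 1 / 2 - 2 ^- J.+1 :> R.
  by rewrite gerBl invr_ge0 exprn_ge0.
elim: J => [|J IH]; first by rewrite big_geq// expr1; lra.
by rewrite big_nat_recr//= IH !exprS; field; rewrite expf_neq0.
Qed.

(* [lam] is the exponent of the Bernstein bound at level [j], for a variance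
   [4 * 4 ^- j] and a tolerance [e / 8 * (j.+1 / 2 ^ j)]: both terms of the
   exponent are then of order [m * e ^ 2], so that one sample size serves all
   levels. *)
Lemma failure_bound (R : realType) (n m j : nat) (e delta lam : R) :
  (0 < n)%N -> 0 < delta < 1 -> lam = e / 128 * 2 ^+ j ->
  6 * (n%:R + ln delta^-1) <= m%:R * e ^+ 2 / 2048 ->
  expR (- (m%:R * (lam * (e / 8 * (j.+1%:R / 2 ^+ j))
          - 2 * lam ^+ 2 * (4 * 4 ^- j)))) <= delta / 2 ^+ (6 * (n + j)).
Proof.
move=> n0 /andP[d0 d1] lamE mE.
have l0 : 0 <= ln delta^-1 by rewrite ln_ge0// invf_ge1// ltW.
apply: (@le_trans _ _ (expR (- ln delta^-1 + - (6 * (n + j))%:R))).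
  rewrite ler_expR.
  (* In units of [m * e ^ 2 / 2048], the linear term contributes [2 * j.+1] and the variance term
     takes away 1. *)
  have -> : m%:R * (lam * (e / 8 * (j.+1%:R / 2 ^+ j))
          - 2 * lam ^+ 2 * (4 * 4 ^- j)) =
      m%:R * e ^+ 2 / 2048 * (2 * j%:R + 1).
    rewrite lamE (_ : 4 ^+ j = 2 ^+ j * 2 ^+ j); last first.
      by rewrite -exprMn; congr (_ ^+ _); ring.
    by rewrite -natr1; field; rewrite expf_neq0.
  rewrite -opprD lerN2.
  have nj : (n + j)%:R <= n%:R * (j%:R + 1) :> R.
    by rewrite natr1 -natrM ler_nat mulnS leq_add2l leq_pmull.
  have j0 : 0 <= j%:R :> R by [].
  have lj : 0 <= ln delta^-1 * j%:R by rewrite mulr_ge0.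
  have j1 : 0 <= 2 * j%:R + 1 :> R by rewrite addr_ge0 ?mulr_ge0.
  apply: le_trans (ler_wpM2r j1 mE).
  rewrite natrM.
  have nj0 : 0 <= n%:R * j%:R :> R by rewrite mulr_ge0.
  have n0' : 0 <= n%:R :> R by [].
  move: (n%:R) (j%:R) (ln _) ((n + j)%:R) l0 nj j0 lj nj0 n0' => a b c d.
  by clear; lra.
rewrite expRD; apply: ler_pM; [exact: expR_ge0|exact: expR_ge0| |
  exact: expRN_le_dyadic].
by rewrite lnV ?posrE// opprK lnK ?posrE.
Qed.

(** The factor 2 counts the link and the bracket of each cell. As [n] is positive, [6 * (n + j)] is
    at least the sum of the exponents [1], [2 * j + n.+2] and [j.+2]. *)
Lemma cell_count_bound (R : realType) (n j : nat) : (0 < n)%N ->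
  (4 ^ j * 2 ^ n.+1 + 1)%:R * (2 / 2 ^+ (6 * (n + j))) <= 2 ^- j.+2 :> R.
Proof.
move=> n0; rewrite mulrA ler_pdivrMr ?exprn_gt0// mulrC -[leRHS]mulrC.
rewrite ler_pdivlMr ?exprn_gt0// -!natrX -!natrM ler_nat.
have le2 : (4 ^ j * 2 ^ n.+1 + 1 <= 2 ^ (2 * j + n.+2))%N.
  have <- : (2 ^ (2 * j) = 4 ^ j)%N by rewrite expnM.
  have : (0 < 2 ^ (2 * j + n.+1))%N by rewrite expn_gt0.
  by rewrite -expnD (addnS _ n.+1) expnS; lia.
apply: (@leq_trans (2 * 2 ^ (2 * j + n.+2) * 2 ^ j.+2)).
  by rewrite leq_mul2r leq_mul2l le2 !orbT.
by rewrite -expnS -expnD leq_exp2l//; lia.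
Qed.

(** Union bound over levels, cells and the two tests of each cell: level [j] fails with probability
    at most [delta / 2 ^ j.+2]. Cells are counted through jumps, so [N] does not enter the sample
    size. *)
Lemma chaining_tail (R : realType) (V : finType) (p : V -> R)
    (n m N : nat) (f : nat -> V -> R) (e delta : R) :
  (forall v, 0 <= p v) -> \sum_v p v = 1 ->
  (forall k v, 0 <= f k v <= 1) ->
  (forall v, p v != 0 -> (\sum_(0 <= i < N) (f i v != f i.+1 v) <= 2 ^ n.+1)%N) ->
  (0 < n)%N -> 0 < e <= 1 -> 0 < delta < 1 ->
  6 * (n%:R + ln delta^-1) <= m%:R * e ^+ 2 / 2048 ->
  prodPr p (fun y : {ffun 'I_m -> V} =>
    has (fun k => e < mean p (f k) - emp_mean y (f k)) (iota 0 N.+1))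
  <= delta / 2.
Proof.
move=> p0 p1 f01 fj n0 e01 d01 mE.
have [/andP[e0 e1] /andP[d0 d1]] := (e01, d01).
have l0 : 0 <= ln delta^-1 by rewrite ln_ge0// invf_ge1// ltW.
have m0 : (0 < m)%N.
  rewrite lt0n; apply/negP => /eqP m0; move: mE; rewrite m0 !mul0r.
  have : 0 < n%:R :> R by rewrite ltr0n.
  lra.
have [J /andP[J1 J2]] := dyadic_scale e01.
pose tol j : R := e / 8 * (j.+1%:R / 2 ^+ j).
pose bad (Z : V -> R) j := fun y : {ffun 'I_m -> V} =>
  mean p Z + tol j < emp_mean y Z.
pose badc j c y := bad (link p N f j c) j y || bad (bracket p N f j c) j y.
have sub (y : {ffun 'I_m -> V}) :
    has (fun k => e < mean p (f k) - emp_mean y (f k)) (iota 0 N.+1) ->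
    has (fun j => has (fun c => badc j c y) (cells p N f j)) (iota 0 J.+1).
  apply: contraTT => /hasPn good; apply/hasPn => k.
  rewrite mem_iota add0n /= ltnS => kN; rewrite -leNgt.
  have good' j c : (j <= J)%N -> c \in cells p N f j -> ~~ badc j c y.
    move=> jJ; have jin : j \in iota 0 J.+1 by rewrite mem_iota.
    by have /hasPn := good j jin; apply.
  apply: le_trans (uniform_deviation p0 f01 (J := J) e0 _ _ kN) _.
  - by move=> j c jJ /(good' _ _ jJ); rewrite negb_or -!leNgt => /andP[].
  - by move=> c /(good' _ _ (leqnn J)); rewrite negb_or -!leNgt => /andP[].
  (* [4 ^ J >= (2 / e) ^ 2 >= 4 / e], so the two bracket terms of the last level cost at most
     [e / 2]. *)
  have : 4 ^- J <= e / 4.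
    rewrite -[leRHS]invrK lef_pV2 ?posrE ?exprn_gt0 ?invr_gt0 ?divr_gt0//.
    rewrite invf_div (_ : 4 ^+ J = 2 ^+ J * 2 ^+ J); last first.
      by rewrite -exprMn; congr (_ ^+ _); ring.
    have e2 : 2 <= 2 / e by rewrite ler_pdivlMr//; lra.
    have e20 : 0 <= 2 / e by rewrite divr_ge0// ltW.
    have := ler_pM e20 e20 J1 J1.
    apply: le_trans; rewrite (_ : 4 / e = 2 * (2 / e)); last by ring.
    by rewrite ler_wpM2r.
  lra.
apply: le_trans (prodPr_le p0 sub) _.
apply: le_trans (prodPr_has p0 _ _) _.
apply: le_trans (_ : \sum_(j <- iota 0 J.+1) delta * 2 ^- j.+2 <= _); last first.
  rewrite -mulr_sumr ler_wpM2l//; first exact: ltW.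
  by have := sum_dyadic_le R J.+1; rewrite /index_iota subn0 mul1r.
rewrite big_seq [leRHS]big_seq; apply: ler_sum => j.
rewrite mem_iota add0n ltnS /= => jJ.
apply: le_trans (prodPr_has p0 _ _) _.
pose q := delta / 2 ^+ (6 * (n + j)).
have lam2 : 0 <= e / 128 * 2 ^+ j <= 1 / 2.
  rewrite mulr_ge0 ?divr_ge0 ?exprn_ge0 ?ltW//=.
  have : 2 ^+ j <= 4 / e by apply: le_trans J2; rewrite ler_eXn2l ?ltr1n.
  by rewrite ler_pdivlMr// => h; lra.
apply: le_trans (_ : \sum_(c <- cells p N f j) (2 * q) <= _).
  rewrite big_seq [leRHS]big_seq; apply: ler_sum => c cj.
  apply: le_trans (prodPrU p0 _ _) _.
  rewrite (_ : 2 * q = q + q); last by ring.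
  apply: lerD; apply: le_trans (failure_bound n0 d01 (erefl _) mE).
    apply: prodPr_bernstein => //; first exact: link_le1.
    exact: link_var cj.
  apply: prodPr_bernstein => //; first exact: bracket_le1.
  exact: bracket_var cj.
rewrite big_const_seq count_predT iter_addr_0 -[leLHS]mulr_natl.
have szc := size_cells p0 p1 fj j.
have q0 : 0 <= 2 * q by rewrite mulr_ge0// divr_ge0 ?exprn_ge0// ltW.
apply: le_trans (_ : (4 ^ j * 2 ^ n.+1 + 1)%:R * (2 * q) <= _).
  by rewrite ler_wpM2r// ler_nat.
rewrite /q (_ : 2 * (delta / _) = delta * (2 / 2 ^+ (6 * (n + j)))); last by ring.
by rewrite mulrCA ler_wpM2l ?cell_count_bound// ltW.
Qed.

(** * Transfer to i.i.d. samples of an arbitrary law *)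

Section FiniteValued.
Variables (d : measure_display) (T : measurableType d) (R : realType).
Variables (V : finType) (Y : T -> V).
Hypothesis mY : forall v, measurable (Y @^-1` [set v]).

Lemma finite_valuedE (c : V -> R) (w : T) :
  c (Y w) = \sum_v c v * \1_(Y @^-1` [set v]) w.
Proof.
rewrite (bigD1 (Y w))//= indicE mem_set//= mulr1 big1 ?addr0// => v vY.
rewrite indicE memNset ?mulr0//= => /esym E.
by rewrite E eqxx in vY.
Qed.

Lemma measurable_finite_valued (c : V -> R) :
  measurable_fun setT (fun w => c (Y w)).
Proof.
under eq_fun do rewrite finite_valuedE.
by apply: measurable_sum => v; apply: measurable_funM => //; apply: measurable_indic.
Qed.

Lemma measurable_finite_valued_set (E : pred V) : measurable [set w | E (Y w)].
Proof.
have -> : [set w | E (Y w)] = \bigcup_(v in [set v | E v]) Y @^-1` [set v].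
  by apply/seteqP; split => [w /= Ew|w [v /= Ev /= ->]//]; exists (Y w).
exact: fin_bigcup_measurable.
Qed.

Lemma integral_finite_valued (mu : {measure set T -> \bar R}) (c : V -> R) :
  (forall v, 0 <= c v) ->
  (\int[mu]_w (c (Y w))%:E = \sum_v (c v)%:E * mu (Y @^-1` [set v]))%E.
Proof.
move=> c0; under eq_integral do rewrite finite_valuedE -sumEFin.
rewrite ge0_integral_sum//.
- apply: eq_bigr => v _; under eq_integral do rewrite EFinM.
  rewrite ge0_integralZl_EFin//.
  + by rewrite integral_indic// setIT.
  + by apply/measurable_EFinP; exact: measurable_indic.
- move=> v; apply/measurable_EFinP.
  by apply: measurable_funM => //; apply: measurable_indic.
- by move=> v w _; rewrite lee_fin mulr_ge0.
Qed.

Lemma measure_finite_valued (mu : {measure set T -> \bar R}) (E : pred V) :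
  (mu [set w | E (Y w)] = \sum_(v | E v) mu (Y @^-1` [set v]))%E.
Proof.
have mE := measurable_finite_valued_set E.
rewrite -[LHS](_ : (\int[mu]_w ((E (Y w))%:R)%:E = _)%E).
  rewrite (integral_finite_valued mu (c := fun v => (E v)%:R))//.
  rewrite [RHS]big_mkcond; apply: eq_bigr => v _.
  by case: (E v); rewrite ?mul1e ?mul0e.
rewrite -[X in mu X]setIT -integral_indic//; apply: eq_integral => w _.
by rewrite indicE; case: (boolP (E (Y w))) => h; [rewrite mem_set|rewrite memNset//; apply/negP].
Qed.

End FiniteValued.

Section UniformDeviation.
Variables (R : realType) (d d' : measure_display) (Om : measurableType d).
Variables (S : measurableType d') (D : probability Om R) (P : probability S R).
Variables (m : nat) (X : 'I_m -> S -> Om).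
Hypothesis iidX : iid D P X.

Lemma iid_finite_valued (V : finType) (Y : Om -> V) (y : {ffun 'I_m -> V}) :
  (forall v, measurable (Y @^-1` [set v])) ->
  let Ys z := [ffun i => Y (X i z)] in
  measurable (Ys @^-1` [set y]) /\
  P (Ys @^-1` [set y]) = (\prod_(i < m) fine (D (Y @^-1` [set y i])))%:E.
Proof.
move=> mY Ys; have [mX PX] := iidX.
have -> : Ys @^-1` [set y] =
    \bigcap_(i in [set: 'I_m]) (X i @^-1` (Y @^-1` [set y i])).
  apply/seteqP; split => [z /= <- i _ /=|z /= h]; first by rewrite ffunE.
  by apply/ffunP => i; rewrite ffunE; exact: (h i I).
split; last exact: PX.
apply: fin_bigcap_measurable => // i _.
by rewrite -[X in measurable X]setTI; apply: mX.
Qed.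

Variables (n N : nat) (u : nat -> Om -> R) (e delta : R).
Hypothesis u01 : forall k w, 0 <= u k w <= 1.
Hypothesis mu : forall k, measurable_fun setT (u k).
Hypothesis u_jumps :
  forall w, (\sum_(0 <= i < N) (u i w != u i.+1 w) <= 2 ^ n.+1)%N.
Hypotheses (n_gt0 : (0 < n)%N) (e_gt0 : 0 < e) (d01 : 0 < delta < 1).
Hypothesis m_large :
  6 * (n%:R + ln delta^-1) <= m%:R * (e / 2) ^+ 2 / 2048.

(** Half of [e] pays for rounding and half for chaining, whence the [e / 2] in the sample size. The
    bad event depends on the sequence, but its probability bound does not depend on [N]. *)
Lemma iid_uniform_deviation :
  exists B : set S, [/\ measurable B, (P B <= (delta / 2)%:E)%E &
    forall z, ~ B z -> forall k, (k <= N)%N ->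
      (\int[D]_w (u k w)%:E <=
       ((\sum_(i < m) u k (X i z)) / m%:R + e)%:E)%E].
Proof.
have [d0 d1] := andP d01.
have l0 : 0 <= ln delta^-1 by rewrite ln_ge0// invf_ge1// ltW.
have m0 : (0 < m)%N.
  rewrite lt0n; apply/negP => /eqP m0; move: m_large; rewrite m0 !mul0r.
  have : 0 < n%:R :> R by rewrite ltr0n.
  lra.
have m0R : 0 < m%:R :> R by rewrite ltr0n.
(* The chaining bound is for tolerances at most 1; beyond that, [u k w <= 1] suffices. *)
have [e2|e2] := ltP 1 (e / 2).
  exists set0; split => //; first by rewrite measure0 lee_fin divr_ge0// ltW.
  move=> z _ k _; apply: (@le_trans _ _ 1%E).
    rewrite -[leRHS]mul1e -[X in (_ <= _ * X)%E](@probability_setT _ _ _ D).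
    rewrite -integral_cst//; apply: ge0_le_integral => //=.
    - by move=> w _; rewrite lee_fin; case/andP: (u01 k w).
    - exact/measurable_EFinP.
    - by move=> w _; rewrite lee_fin; case/andP: (u01 k w).
  rewrite lee_fin.
  have : 0 <= (\sum_(i < m) u k (X i z)) / m%:R.
    by rewrite divr_ge0// sumr_ge0// => i _; case/andP: (u01 k (X i z)).
  lra.
(* Rounding each [u k] down to a multiple of [1 / M] makes the vector [Y] of all
   the [u k] finite-valued, so that the i.i.d. hypothesis on rectangles determines
   the law of the whole sample. *)
pose M := (Num.truncn (2 / e)).+1.
have M0 : 0 < M%:R :> R by rewrite ltr0n.
have M_large : M%:R^-1 <= e / 2.
  have h : 0 <= 2 / e by rewrite divr_ge0// ltW.
  have /andP[_ /ltW] := truncn_itv h; rewrite -/M => hM.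
  by rewrite -[leRHS]invrK lef_pV2 ?posrE ?invr_gt0 ?divr_gt0// invf_div.
pose V : finType := {ffun 'I_N.+1 -> 'I_M.+1}.
pose Y w : V := [ffun k : 'I_N.+1 => inord (Num.truncn (M%:R * u k w))].
pose f (k : nat) (v : V) : R := (v (inord k))%:R / M%:R.
pose p v := fine (D (Y @^-1` [set v])).
have Mu0 k w : 0 <= M%:R * u k w.
  by rewrite mulr_ge0//; case/andP: (u01 k w).
have Yval (k : 'I_N.+1) w : (Y w k = Num.truncn (M%:R * u k w) :> nat)%N.
  rewrite ffunE inordK// ltnS -(ler_nat R).
  have /andP[+ _] := truncn_itv (Mu0 k w); move=> /le_trans; apply.
  by rewrite ler_piMr//; case/andP: (u01 k w).
have fY k w : (k <= N)%N -> f k (Y w) <= u k w <= f k (Y w) + M%:R^-1.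
  move=> kN; have := truncn_itv (Mu0 k w).
  rewrite /f Yval inordK// => /andP[h1 h2].
  rewrite ler_pdivrMr// [u k w * _]mulrC h1 /=.
  rewrite -[X in _ + X]mul1r -mulrDl ler_pdivlMr// [u k w * _]mulrC natr1.
  exact: ltW.
have mY v : measurable (Y @^-1` [set v]).
  have -> : Y @^-1` [set v] = \bigcap_(k in [set: 'I_N.+1])
      ((fun w => M%:R * u k w) @^-1` `[(v k)%:R, (v k).+1%:R[).
    apply/seteqP; split => [w /= <- k _ /=|w /= h].
      by rewrite Yval in_itv/=; exact: truncn_itv.
    apply/ffunP => k; apply/val_inj => /=; rewrite Yval; apply: truncn_def.
    by have := h k I; rewrite /= in_itv.
  apply: fin_bigcap_measurable => // k _.
  rewrite -[X in measurable X]setTI.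
  have mM : measurable_fun setT (fun w => M%:R * u k w).
    by apply: measurable_funM.
  by apply: mM => //; exact: measurable_itv.
have p0 v : 0 <= p v by rewrite fine_ge0.
have pE v : (D (Y @^-1` [set v]) = (p v)%:E)%E.
  by rewrite /p fineK// fin_num_measure.
have p1 : \sum_v p v = 1.
  have := measure_finite_valued mY D predT.
  have -> : [set w | predT (Y w)] = setT by apply/seteqP; split.
  rewrite (eq_bigr (fun v => (p v)%:E)) => [|v _]; last exact: pE.
  by rewrite sumEFin [X in X = _](@probability_setT _ _ _ D) => -[<-].
have f01 k v : 0 <= f k v <= 1.
  rewrite divr_ge0//= ler_pdivrMr// mul1r ler_nat -ltnS.
  exact: ltn_ord.
have Eu k : (k <= N)%N ->
    (\int[D]_w (u k w)%:E <= (mean p (f k) + M%:R^-1)%:E)%E.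
  move=> kN.
  have -> : mean p (f k) + M%:R^-1 = mean p (fun v => f k v + M%:R^-1).
    rewrite -[X in _ + X](mean_const p1) /mean -big_split.
    by apply: eq_bigr => v _; rewrite mulrDr.
  have -> : (mean p (fun v => f k v + M%:R^-1))%:E =
      (\int[D]_w (f k (Y w) + M%:R^-1)%:E)%E.
    rewrite (integral_finite_valued mY D (c := fun v => f k v + M%:R^-1)).
      rewrite /mean -sumEFin; apply: eq_bigr => v _.
      by rewrite [X in (_ * X)%E]pE -EFinM mulrC.
    by move=> v; rewrite addr_ge0 ?invr_ge0//; case/andP: (f01 k v).
  apply: ge0_le_integral => //=.
  - by move=> w _; rewrite lee_fin; case/andP: (u01 k w).
  - exact/measurable_EFinP.
  - apply/measurable_EFinP.
    exact: (measurable_finite_valued mY (fun v => f k v + M%:R^-1)).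
  - by move=> w _; rewrite lee_fin; case/andP: (fY k w kN).
pose Ys z : {ffun 'I_m -> V} := [ffun i => Y (X i z)].
pose E (y : {ffun 'I_m -> V}) := has
  (fun k => e / 2 < mean p (f k) - emp_mean y (f k)) (iota 0 N.+1).
have mYs y : measurable (Ys @^-1` [set y]).
  by have [] := iid_finite_valued y mY.
exists [set z | E (Ys z)]; split.
- exact: measurable_finite_valued_set.
- rewrite (measure_finite_valued mYs).
  rewrite (eq_bigr (fun y : {ffun 'I_m -> V} => (\prod_i p (y i))%:E)); last first.
    by move=> y _; have [_] := iid_finite_valued y mY.
  rewrite sumEFin lee_fin.
  apply: (chaining_tail (n := n)) => // [v pv0|]; last by rewrite divr_gt0.
  (* A fibre of nonzero probability contains an outcome [w], whose jumps are bounded; rounding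
     creates no new jump. *)
  have [w Yw] : exists w, Y w = v.
    apply: contrapT => nw; move: pv0; rewrite /p (_ : _ @^-1` _ = set0).
      by rewrite measure0 eqxx.
    by apply/seteqP; split => // w Yw; apply: nw; exists w.
  apply: leq_trans (u_jumps w); rewrite big_nat [leqRHS]big_nat.
  apply: leq_sum => i /andP[_ iN]; rewrite /f -Yw !Yval !inordK//; last exact: ltnW.
  have [->|_] := eqVneq (u i w) (u i.+1 w); first by rewrite eqxx.
  by rewrite leq_b1.
- move=> z /negP; rewrite /E => /hasPn nE k kN.
  apply: le_trans (Eu k kN) _; rewrite lee_fin.
  have /nE : k \in iota 0 N.+1 by rewrite mem_iota.
  rewrite -leNgt.
  have : emp_mean (Ys z) (f k) <= (\sum_(i < m) u k (X i z)) / m%:R.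
    rewrite ler_wpM2r ?invr_ge0//; apply: ler_sum => i _.
    by rewrite ffunE; case/andP: (fY k (X i z) kN).
  lra.
Qed.

End UniformDeviation.

(** * Equilibria and loss as functions of the subsidy *)

Section ComponentMaintenance.
Variables (R : realType) (n : nat) (H : R) (G : game R n).

Definition total_cost (s : profile n) : R := \sum_i agent_cost G i s.

(** Adding back [n_s * sigma] cancels the subsidies, so [sigma] acts on the loss only through the
    set of equilibria. *)
Lemma social_cost_subsidy (sigma : R) (s : profile n) :
  social_cost G sigma s + (n_repair s)%:R * sigma = total_cost s.
Proof.
have -> : (n_repair s)%:R = \sum_i (s i)%:R :> R.
  rewrite /n_repair -sum1_card natr_sum big_mkcond/=; apply: eq_bigr => i _.
  by case: (boolP (s i)) => si; [rewrite mem_set|rewrite memNset//; exact/negP].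
by rewrite /social_cost /sub_cost sumrB -mulr_sumr [sigma * _]mulrC subrK.
Qed.

Lemma loss_priorE (sigma : R) : loss_prior G sigma =
  \big[Num.max/0]_(s : profile n | is_NE G sigma s) total_cost s.
Proof. by apply: eq_bigr => s _; rewrite social_cost_subsidy. Qed.

Lemma loss_prior_ge0 (sigma : R) : 0 <= loss_prior G sigma.
Proof. by rewrite loss_priorE; exact: bigmax_ge_id. Qed.

(** Each equilibrium condition compares two costs affine in the subsidy. *)
Lemma is_NE_convex (s : profile n) (x y z : R) : x <= y <= z ->
  is_NE G x s -> is_NE G z s -> is_NE G y s.
Proof.
move=> /andP[xy yz] /forallP nex /forallP nez.
apply/forallP => i; apply/forallP => b.
have := forallP (nex i) b; have := forallP (nez i) b.
rewrite /sub_cost; move: (agent_cost _ _ _) (agent_cost _ _ _) => c c'.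
by case: (s i) (deviate s i b i) => -[]; rewrite /= ?mulr1 ?mulr0; lra.
Qed.

(** A violated inequality stays violated while the subsidy moves by less than the slack, since the
    two actions differ by at most 1. *)
Lemma is_NE_closed (s : profile n) (x : R) : ~~ is_NE G x s ->
  exists2 r, 0 < r & forall y, `|y - x| < r -> ~~ is_NE G y s.
Proof.
rewrite negb_forall => /existsP[i]; rewrite negb_forall => /existsP[b].
rewrite -ltNge -subr_gt0 => r0; eexists; first exact: r0.
move=> y yx; rewrite negb_forall; apply/existsP; exists i.
rewrite negb_forall; apply/existsP; exists b; rewrite -ltNge.
move: yx {r0}; rewrite /sub_cost.
move: (agent_cost _ _ _) (agent_cost _ _ _) => c c'; rewrite ltr_norml.
by case: (s i) (deviate s i b i) => -[]; rewrite /= ?mulr1 ?mulr0; lra.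
Qed.

(** Near [x], only equilibria at [x] can be equilibria, so the maximum runs over a smaller set. The
    least radius over the finitely many profiles is positive. *)
Lemma loss_prior_usc (x : R) :
  exists2 r, 0 < r &
    forall y, `|y - x| < r -> loss_prior G y <= loss_prior G x.
Proof.
have /choice[r rP] (s : profile n) : exists r, 0 < r /\
    forall y, `|y - x| < r -> is_NE G y s -> is_NE G x s.
  have [?|/is_NE_closed[r r0 rP]] := boolP (is_NE G x s); first by exists 1.
  by exists r; split=> // y /rP/negP.
exists (\big[Num.min/1]_(s : profile n) r s).
  by apply: lt_bigmin => // s _; case: (rP s).
move=> y yx; rewrite !loss_priorE; apply: bigmax_le; first exact: bigmax_ge_id.
move=> s NEy; apply: le_bigmax_cond; apply: (rP s).2 NEy.
by apply: lt_le_trans yx _; exact: bigmin_le.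
Qed.

Hypothesis validG : valid_game H G.

Lemma reliability_ge0 (s : profile n) : 0 <= reliability G s.
Proof.
have [theta01 _] := validG; apply: sumr_ge0 => x _; rewrite mulr_ge0//.
apply: prodr_ge0 => i _; have := theta01 i.
by case: (x i) => /andP[]//; rewrite subr_ge0.
Qed.

Lemma loss_prior_le (sigma : R) : 1 <= H -> loss_prior G sigma <= 2 * n%:R * H.
Proof.
move=> H1; rewrite loss_priorE; apply: bigmax_le => [|s _].
  by rewrite !mulr_ge0//; lra.
apply: (@le_trans _ _ (\sum_(i < n) (H + 1))); last first.
  rewrite sumr_const card_ord -[leLHS]mulr_natr mulrAC ler_wpM2r//; lra.
apply: ler_sum => i _; have [_ /(_ i)] := validG; have := reliability_ge0 s.
by rewrite /agent_cost; case: (s i); rewrite /= ?mulr1 ?mulr0; lra.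
Qed.

End ComponentMaintenance.

(** The indices where [b] holds form an interval, with at most one entry and one exit. *)
Lemma convex_changes_le2 (b : nat -> bool) (N : nat) :
  (forall i j k, (i <= j <= k)%N -> (k <= N)%N -> b i -> b k -> b j) ->
  (\sum_(0 <= i < N) (b i != b i.+1) <= 2)%N.
Proof.
move=> cvx.
(* Strengthened for the induction: no change if [b] has never held, at most the entry while it still
   holds. *)
suff : ((forall i, (i <= N)%N -> ~~ b i) ->
    \sum_(0 <= i < N) (b i != b i.+1) = 0)%N /\
    (\sum_(0 <= i < N) (b i != b i.+1) <= if b N then 1 else 2)%N.
  by case=> _ /leq_trans; apply; case: (b N).
elim: N cvx => [|N IH] cvx; first by rewrite big_geq//; split => //; case: (b 0).
have [|IH0 IH1] := IH.
  by move=> i j k ijk kN; apply: cvx => //; exact: leqW.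
rewrite big_nat_recr//=; split.
  move=> nb; rewrite IH0 => [|i iN]; last by rewrite nb// leqW.
  by rewrite (negbTE (nb N _))// (negbTE (nb N.+1 _)).
case bN : (b N) IH1; case bN1 : (b N.+1) => /= IH1; rewrite ?addn0 ?addn1//.
rewrite IH0// => i iN; apply/negP => bi.
by have := cvx i N N.+1; rewrite iN leqnSn leqnn bi bN bN1 => /(_ isT isT isT isT).
Qed.

(** When the loss changes, some profile gains or loses the equilibrium property; each of the [2 ^ n]
    profiles does so at most twice. *)
Lemma loss_prior_changes (R : realType) (n N : nat) (G : game R n)
    (t : nat -> R) :
  (forall i j, (i <= j)%N -> (j <= N)%N -> t i <= t j) ->
  (\sum_(0 <= i < N) (loss_prior G (t i) != loss_prior G (t i.+1))
    <= 2 ^ n.+1)%N.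
Proof.
move=> t_le.
apply: (@leq_trans (\sum_(0 <= i < N) \sum_(s : profile n)
    (is_NE G (t i) s != is_NE G (t i.+1) s))).
  apply: leq_sum => i _; case: (boolP (_ != _)) => //=; apply: contraNT.
  rewrite -eqn0Ngt sum_nat_eq0 => /forallP eqNE; rewrite !loss_priorE.
  apply/eqP; apply: eq_bigl => s.
  by have := eqNE s; rewrite /= eqb0 negbK => /eqP.
rewrite exchange_big/= (@leq_trans (\sum_(s : profile n) 2))//.
  apply: leq_sum => s _; apply: convex_changes_le2 => i j k /andP[ij jk] kN.
  apply: is_NE_convex; rewrite !t_le//; exact: leq_trans jk kN.
by rewrite sum_nat_const card_ffun card_bool card_ord expnS mulnC.
Qed.

(** * Empirical risk minimization *)

(* Density in the graph of [F] makes the sequence sufficient for a discontinuous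
   [F]. *)
Lemma graph_dense_seq (R : realType) (A : set R) (F : R -> R) (a0 : R) : A a0 ->
  exists2 q : nat -> R, (forall l, A (q l)) &
    forall x r, A x -> 0 < r -> exists l, `|q l - x| < r /\ `|F (q l) - F x| < r.
Proof.
move=> Aa0.
(* The part of the graph of [F] over [A] in a grid square of side [1 / k.+1], projected to the line.
   The codes are countable, and [q] picks one point from each nonempty box. *)
pose box (c : nat * int * int) : set R := [set x | [/\ A x,
  Num.floor (c.1.1.+1%:R * x) = c.1.2 & Num.floor (c.1.1.+1%:R * F x) = c.2]].
pose q l := if unpickle l is Some c then
  (if pselect (exists x, box c x) then xget a0 (box c) else a0) else a0.
exists q => [l|x r Ax r0].
  rewrite /q; case: (unpickle l) => [c|//]; case: pselect => // exb.
  by have [] := xgetPex a0 exb.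
have floor_close k (y z : R) : Num.floor (k.+1%:R * y) = Num.floor (k.+1%:R * z) ->
    `|y - z| < k.+1%:R^-1.
  move=> yz; have := floor_itv (k.+1%:R * y); have := floor_itv (k.+1%:R * z).
  rewrite yz intrD => /andP[z1 z2] /andP[y1 y2].
  rewrite -[ltRHS]mul1r ltr_pdivlMr ?ltr0n// mulrC -[X in X * _]ger0_norm//.
  rewrite -normrM mulrBr ltr_norml; move: z1 z2 y1 y2.
  by move: (_ * y) (_ * z) => y' z'; lra.
pose k := Num.truncn r^-1.
have kr : k.+1%:R^-1 < r.
  by rewrite -[ltRHS]invrK ltf_pV2 ?posrE ?invr_gt0 ?ltr0n// truncnS_gt.
pose c := (k, Num.floor (k.+1%:R * x), Num.floor (k.+1%:R * F x)).
exists (pickle c); rewrite /q pickleK; case: pselect => [exb|[]]; last by exists x.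
have [_ /floor_close h1 /floor_close h2] := xgetPex a0 exb.
by split; exact: lt_trans kr.
Qed.

(** Continuity from below: the intersections increase with [k], and each lies in [B k]. This glues
    bad events obtained separately for each finite prefix of a sequence. *)
Lemma measure_liminf_le (d : measure_display) (T : measurableType d)
    (R : realType) (mu : {measure set T -> \bar R}) (B : nat -> set T) (x : \bar R) :
  (forall l, measurable (B l)) -> (forall l, mu (B l) <= x)%E ->
  let C := \bigcup_k \bigcap_(l in [set l | (k <= l)%N]) B l in
  measurable C /\ (mu C <= x)%E.
Proof.
move=> mB Bx; pose F k := \bigcap_(l in [set l | (k <= l)%N]) B l.
have mF k : measurable (F k) by apply: bigcap_measurableType.
have mC : measurable (\bigcup_k F k) by apply: bigcupT_measurable.
split=> //; apply: (cvge_to_le (nondecreasing_cvg_mu mF mC _)).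
  move=> k k' kk'; apply/subsetPset => z Fz l /= k'l.
  by apply: Fz; exact: leq_trans kk' k'l.
near=> k; apply: le_trans (Bx k).
by apply: le_measure; rewrite ?inE// => z; apply; exact: leqnn.
Unshelve. all: by end_near. Qed.

(** * Expectations of bounded losses *)

Section BoundedIntegral.
Variables (R : realType) (d : measure_display) (Om : measurableType d).
Variables (D : probability Om R) (L : Om -> R) (b : R).
Hypothesis L0b : forall w, 0 <= L w <= b.
Hypothesis mL : measurable_fun setT L.

Lemma bounded_integrable : D.-integrable setT (EFin \o L).
Proof.
apply: measurable_bounded_integrable => //.
  by rewrite (le_lt_trans (probability_le1 _ _))// ltry.
exists b; split; first exact: num_real.
move=> x bx w _ /=; have /andP[L0 Lb] := L0b w.
by rewrite ger0_norm// (le_trans Lb)// ltW.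
Qed.

Lemma integral_boundedE :
  (\int[D]_w (L w)%:E = (fine (\int[D]_w (L w)%:E))%:E)%E.
Proof. by rewrite fineK//; exact: (integrable_fin_num _ bounded_integrable). Qed.

Lemma integral_div :
  (\int[D]_w (L w / b)%:E = (fine (\int[D]_w (L w)%:E) / b)%:E)%E.
Proof.
under eq_integral do rewrite mulrC EFinM.
by rewrite integralZl//; [rewrite integral_boundedE -EFinM mulrC|exact: bounded_integrable].
Qed.

Lemma integral_complement :
  (\int[D]_w (b - L w)%:E = (b - fine (\int[D]_w (L w)%:E))%:E)%E.
Proof.
under eq_integral do rewrite EFinB.
rewrite integralB_EFin//; [|exact: finite_measure_integrable_cst|exact: bounded_integrable].
rewrite [X in (X - _)%E](integral_cst D _ b%:E)// integral_boundedE.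
by rewrite [X in (_ * X)%E](@probability_setT _ _ _ D) mule1.
Qed.

End BoundedIntegral.

Section EmpiricalRiskMinimization.
Variables (R : realType) (d d' : measure_display) (Om : measurableType d).
Variables (S : measurableType d') (D : probability Om R) (P : probability S R).
Variables (m : nat) (X : 'I_m -> S -> Om).
Hypothesis iidX : iid D P X.
Variables (n : nat) (H b eps delta : R) (L : Om -> R -> R).
Hypotheses (n_gt0 : (0 < n)%N) (H_ge0 : 0 <= H) (b_gt0 : 0 < b).
Hypotheses (eps_gt0 : 0 < eps) (d01 : 0 < delta < 1).
Hypothesis L0b : forall w x, 0 <= L w x <= b.
Hypothesis mL : forall x, 0 <= x <= H -> measurable_fun setT (L^~ x).
Hypothesis L_changes : forall w N (t : nat -> R),
  (forall i j, (i <= j)%N -> (j <= N)%N -> t i <= t j) ->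
  (\sum_(0 <= i < N) (L w (t i) != L w (t i.+1)) <= 2 ^ n.+1)%N.
Hypothesis L_usc : forall w x,
  exists2 r, 0 < r & forall y, `|y - x| < r -> L w y <= L w x.
Hypothesis m_large :
  6 * (n%:R + ln delta^-1) <= m%:R * (eps / 4 / b / 2) ^+ 2 / 2048.

Definition true_risk (x : R) : R := fine (\int[D]_w (L w x)%:E)%E.
Definition emp_risk (z : S) (x : R) : R := (\sum_(k < m) L (X k z) x) / m%:R.

Lemma true_riskE x : 0 <= x <= H -> (\int[D]_w (L w x)%:E = (true_risk x)%:E)%E.
Proof. by move=> /mL; exact: (integral_boundedE D (L0b ^~ x)). Qed.

Lemma emp_scale (h : 'I_m -> R) :
  (\sum_(k < m) h k / b) / m%:R + eps / 4 / b =
  ((\sum_(k < m) h k) / m%:R + eps / 4) / b.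
Proof. by rewrite -mulr_suml mulrDl mulrAC. Qed.

(** Every prefix has a bad event with the same probability bound, whatever its length. A point
    outside their limit inferior avoids the bad events of arbitrarily long prefixes. *)
Lemma sequence_deviation (q : nat -> R) : (forall l, 0 <= q l <= H) ->
  exists B : set S, [/\ measurable B, (P B <= (delta / 2)%:E)%E &
    forall z, ~ B z -> forall l, true_risk (q l) <= emp_risk z (q l) + eps / 4].
Proof.
move=> qH.
have prefix l : exists B : set S, [/\ measurable B, (P B <= (delta / 2)%:E)%E &
    forall z, ~ B z -> forall l', (l' <= l)%N ->
      true_risk (q l') <= emp_risk z (q l') + eps / 4].
  (* Sorting turns the prefix into an increasing sequence, along which changes of the loss are
     bounded. *)
  pose s := sort <=%O [seq q i | i <- iota 0 l.+1].
  have ss : size s = l.+1 by rewrite size_sort size_map size_iota.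
  pose t i := nth 0 s i.
  have tH i : 0 <= t i <= H.
    have [il|il] := ltnP i (size s); last by rewrite /t nth_default// lexx.
    have := mem_nth 0 il; rewrite mem_sort => /mapP[j _ E].
    by rewrite /t E.
  have t_le i j : (i <= j)%N -> (j <= l)%N -> t i <= t j.
    move=> ij jl; apply: le_sorted_leq_nth => //; first exact: sort_le_sorted.
      by rewrite inE ss ltnS (leq_trans ij).
    by rewrite inE ss ltnS.
  have [||||B [mB PB Bz]] := iid_uniform_deviation iidX (n := n) (N := l)
    (u := fun k w => L w (t k) / b) (e := eps / 4 / b) _ _ _ n_gt0 _ d01 m_large.
  - move=> k w; have /andP[L0 Lb] := L0b w (t k).
    by rewrite divr_ge0 ?(ltW b_gt0)//= ler_pdivrMr// mul1r.
  - by move=> k; apply: measurable_funM => //; exact: mL.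
  - move=> w; apply: leq_trans (L_changes w t_le); apply: leq_sum => i _.
    by have [->|_] := eqVneq (L w (t i)) (L w (t i.+1)); rewrite ?eqxx ?leq_b1.
  - by rewrite !divr_gt0.
  exists B; split=> // z /Bz {}Bz l' l'l.
  have : q l' \in s by rewrite mem_sort map_f// mem_iota.
  move=> /(nthP 0)[k]; rewrite ss ltnS => kl <-.
  have := Bz k kl; rewrite (integral_div D (L0b ^~ (t k)) (mL (tH k))).
  by rewrite lee_fin emp_scale ler_pM2r// invr_gt0.
have /choice[B BP] := prefix.
have [] := @measure_liminf_le _ _ _ P B (delta / 2)%:E.
- by move=> l; case: (BP l).
- by move=> l; case: (BP l).
move=> mC PC; eexists; split; [exact: mC|exact: PC|].
move=> z nCz l; have [k lk nBz] : exists2 k, (l <= k)%N & ~ B k z.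
  apply: contrapT => h; apply: nCz; exists l => // k /= lk.
  by apply: contrapT => nB; apply: h; exists k.
by have [_ _ /(_ z nBz l lk)] := BP k.
Qed.

(** The reverse inequality, obtained from the complement [b - L] at a point fixed before sampling;
    the sequence has one term, hence no jumps. *)
Lemma point_deviation (x : R) : 0 <= x <= H ->
  exists B : set S, [/\ measurable B, (P B <= (delta / 2)%:E)%E &
    forall z, ~ B z -> emp_risk z x <= true_risk x + eps / 4].
Proof.
move=> xH; have m_gt0 : 0 < m%:R :> R.
  rewrite ltr0n lt0n; apply/negP => /eqP m0; move: m_large; rewrite m0 !mul0r.
  have [d0 d1] := andP d01.
  have : 0 <= ln delta^-1 by rewrite ln_ge0// invf_ge1// ltW.
  have : 0 < n%:R :> R by rewrite ltr0n.
  lra.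
have [||||B [mB PB Bz]] := iid_uniform_deviation iidX (n := n) (N := 0)
  (u := fun _ w => (b - L w x) / b) (e := eps / 4 / b) _ _ _ n_gt0 _ d01 m_large.
- move=> k w; have /andP[L0 Lb] := L0b w x.
  by rewrite divr_ge0 ?subr_ge0 ?(ltW b_gt0)//= ler_pdivrMr// mul1r gerBl.
- move=> k; apply: measurable_funM => //; apply: measurable_funB => //.
  exact: mL.
- by move=> w; rewrite big_geq.
- by rewrite !divr_gt0.
exists B; split=> // z /Bz /(_ 0%N isT).
have L'0b w : 0 <= b - L w x <= b.
  by have /andP[L0 Lb] := L0b w x; rewrite subr_ge0 Lb gerBl.
have mL' : measurable_fun setT (fun w => b - L w x).
  by apply: measurable_funB => //; exact: mL.
rewrite (integral_div D L'0b mL').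
rewrite (integral_complement D (L0b ^~ x) (mL xH)) lee_fin emp_scale.
rewrite ler_pM2r ?invr_gt0// sumrB sumr_const card_ord -[b *+ m]mulr_natr.
rewrite mulrBl [b * _ / _]mulfK ?gt_eqF//= /emp_risk /true_risk.
move: (fine _) (_ / m%:R) => x1 x2; lra.
Qed.

(** Each quarter of [eps] pays for one step: choosing a near-minimizer [x0], its empirical risk, the
    deviation along [q], and replacing [true_risk x] by [true_risk (q l)]. The good event is fixed
    before the empirical minimizer is. *)
Lemma erm_excess_risk :
  exists A : set S, [/\ measurable A, ((1 - delta)%:E <= P A)%E &
    forall z, A z -> forall x, 0 <= x <= H ->
    (forall y, 0 <= y <= H -> emp_risk z x <= emp_risk z y) ->
    forall y, 0 <= y <= H -> true_risk x <= true_risk y + eps].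
Proof.
have I0 : 0 <= (0 : R) <= H by rewrite lexx.
have [q qH qdense] := graph_dense_seq (A := [set x | 0 <= x <= H]) true_risk I0.
have [B1 [mB1 PB1 B1z]] := sequence_deviation qH.
have risk_ge0 x : 0 <= x <= H -> 0 <= true_risk x.
  move=> xH; rewrite -lee_fin -true_riskE//; apply: integral_ge0 => w _.
  by rewrite lee_fin; case/andP: (L0b w x).
have [x0 x0H x0min] : exists2 x0, 0 <= x0 <= H &
    forall y, 0 <= y <= H -> true_risk x0 <= true_risk y + eps / 4.
  pose E := true_risk @` [set x | 0 <= x <= H].
  have hE : has_inf E.
    split; first by exists (true_risk 0), 0.
    by exists 0 => _ [y yH <-]; exact: risk_ge0.
  have [_ [x xH <-] xE] := inf_adherent (divr_gt0 eps_gt0 (ltr0Sn R 3)) hE.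
  exists x => // y yH; apply: le_trans (ltW xE) _; rewrite lerD2r.
  by apply: ge_inf; [exact: hE.2|exists y].
have [B2 [mB2 PB2 B2z]] := point_deviation x0H.
exists (~` (B1 `|` B2)); split.
- by apply: measurableC; apply: measurableU.
- rewrite probability_setC; last exact: measurableU.
  have : (P (B1 `|` B2) <= delta%:E)%E.
    apply: le_trans (measureU2 P mB1 mB2) _.
    by rewrite (_ : delta = delta / 2 + delta / 2); [rewrite EFinD leeD|lra].
  by move=> h; rewrite EFinB leeB.
move=> z; rewrite setCU => -[nB1 nB2] x xH xmin y yH.
(* The sample is finite, so one radius serves all its losses at [x]. *)
have [r r0 rP] : exists2 r, 0 < r & forall k x', `|x' - x| < r ->
    L (X k z) x' <= L (X k z) x.
  have /choice[r rP] (k : 'I_m) : exists r, 0 < r /\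
      forall x', `|x' - x| < r -> L (X k z) x' <= L (X k z) x.
    by have [r r0 rP] := L_usc (X k z) x; exists r.
  exists (\big[Num.min/1]_(k < m) r k).
    by apply: lt_bigmin => // k _; case: (rP k).
  move=> k x' x'x; apply: (rP k).2; apply: lt_le_trans x'x _.
  exact: bigmin_le.
have r'0 : 0 < Num.min r (eps / 4) by rewrite lt_min r0 divr_gt0.
have [l [ql Rl]] := qdense x _ xH r'0.
move: ql Rl; rewrite !lt_min => /andP[ql _] /andP[_ Rl].
have h1 : emp_risk z (q l) <= emp_risk z x.
  by rewrite ler_wpM2r ?invr_ge0//; apply: ler_sum => k _; exact: rP.
have := B1z z nB1 l; have := B2z z nB2; have := x0min y yH.
have := xmin x0 x0H; move: Rl; rewrite ltr_norml; lra.
Qed.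

End EmpiricalRiskMinimization.

(** * Sample size for learning a uniform subsidy *)

Theorem theorem9 (R : realType) :
  exists c : R, 0 < c /\
  forall (n : nat) (H eps delta : R),
    1 <= H -> 0 < eps -> 0 < delta ->
  forall m : nat,
    c * (n%:R ^+ 2 * H ^+ 2 / eps ^+ 2) * (n%:R + ln delta^-1) <= m%:R ->
  forall (d : measure_display) (Om : measurableType d)
         (D : probability Om R) (g : Om -> game R n),
    (forall w, valid_game H (g w)) ->
    (forall sigma, 0 <= sigma <= H ->
       measurable_fun setT (fun w => loss_prior (g w) sigma)) ->
  forall (d' : measure_display) (S : measurableType d')
         (P : probability S R) (X : 'I_m -> S -> Om),
    iid D P X ->
    exists A : set S, measurable A /\ ((1 - delta)%:E <= P A)%E /\
      forall z, A z ->
      forall sh, is_ERM H (fun k => g (X k z)) sh ->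
      forall sigma, 0 <= sigma <= H ->
        (exp_loss D g sh <= exp_loss D g sigma + eps%:E)%E.
Proof.
have c0 : 0 < 2048 * 256 :> R by rewrite mulr_gt0 ?ltr0n.
(* Losses in [[0, 2 * n * H]], accuracy [eps / 4] and the halving for rounding give the tolerance
   [eps / (16 * n * H)], whose square yields 256; 6 and 2048 come from [failure_bound]. *)
exists (6 * (2048 * 256)); split; first by rewrite mulr_gt0.
move=> n H eps delta H1 eps0 delta0 m mE d Om D g gH mg d' S P X iidX.
have loss_bounds w x : 0 <= loss_prior (g w) x <= 2 * n%:R * H.
  by rewrite loss_prior_ge0 (loss_prior_le (gH w)).
have [d1|d1] := leP 1 delta.
  exists set0; split; first exact: measurable0.
  by rewrite measure0 lee_fin subr_le0.
(* Without agents, the bound [2 * n * H] forces every loss to be 0. *)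
have [n0|n0] := posnP n.
  exists setT; split; first exact: measurableT.
  split=> [|z _ sh _ sigma _]; first by rewrite probability_setT lee_fin gerBl ltW.
  have loss0 x : exp_loss D g x = 0%E.
    apply: integral0_eq => w _; congr EFin; apply/le_anti.
    by have := loss_bounds w x; rewrite [n%:R](_ : _ = 0) ?n0// mulr0 mul0r andbC.
  by rewrite !loss0 add0e lee_fin ltW.
have b0 : 0 < 2 * n%:R * H by rewrite !mulr_gt0 ?ltr0n//; lra.
have m_large : 6 * (n%:R + ln delta^-1) <=
    m%:R * (eps / 4 / (2 * n%:R * H) / 2) ^+ 2 / 2048.
  have q0 : 0 < n%:R ^+ 2 * H ^+ 2 / eps ^+ 2 :> R.
    by rewrite divr_gt0 ?mulr_gt0 ?exprn_gt0 ?ltr0n//; lra.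
  have -> : m%:R * (eps / 4 / (2 * n%:R * H) / 2) ^+ 2 / 2048 =
      m%:R / (2048 * 256 * (n%:R ^+ 2 * H ^+ 2 / eps ^+ 2)) :> R.
    by field; rewrite !gt_eqF ?ltr0n//; lra.
  rewrite ler_pdivlMr ?(mulr_gt0 c0 q0)//; apply: le_trans mE.
  by rewrite le_eqVlt; apply/orP; left; apply/eqP; ring.
have [||||A [mA PA Az]] := erm_excess_risk iidX (H := H)
  (L := fun w x => loss_prior (g w) x) n0 _ b0 eps0 _ loss_bounds mg _ _ m_large.
- by lra.
- by rewrite delta0.
- by move=> w N t; exact: loss_prior_changes.
- by move=> w x; exact: loss_prior_usc.
exists A; split=> //; split=> // z /Az {}Az sh [shH sh_min] sigma sigmaH.
have := Az sh shH sh_min sigma sigmaH.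
by rewrite /exp_loss !(true_riskE D loss_bounds mg).
Qed.
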